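(* Let $n\ge2$, $a\in\mathbb{R}^n$, $D=\mathbb{R}^n\setminus\{a\}$, $x\in D$, and $t>0$. Then $$B_j(x,r)\subset B_c(x,t)\subset B_j(x,R),$$ where $$r=\log(1+t|x-a|)\qquad\text{and}\qquad R=\log\left(\frac{1}{1-t|x-a|}\right).$$ The radii $r$ and $R$ are best possible. Moreover, $R/r\to1$ as $t\to0$.
   Context: $|\cdot|$ is the Euclidean norm. For $D=\mathbb{R}^n\setminus\{a\}$, the Cassinian metric, defined for a general domain $D\subsetneq\mathbb{R}^n$ by $c_D(x,y)=\sup_{p\in\partial D}\frac{|x-y|}{|x-p||p-y|}$ (supremum over finite boundary points), is $$c_D(x,y)=\frac{|x-y|}{|x-a||y-a|},$$ and the distance ratio metric, defined in general by $j_D(x,y)=\log\left(1+\frac{|x-y|}{\min\{\delta_D(x),\delta_D(y)\}}\right)$ with $\delta_D(z)=\mathrm{dist}(z,\partial D)$ the Euclidean distance from $z$ to $\partial D$, is $$j_D(x,y)=\log\left(1+\frac{|x-y|}{\min\{|x-a|,|y-a|\}}\right).$$ The balls are $B_c(x,t)=\{y\in D:c_D(x,y)<t\}$ and $B_j(x,r)=\{y\in D:j_D(x,y)<r\}$.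
   Formalization: The claims about R (the inclusion of B_c(x,t) in B_j(x,R) and that R is best possible) are stated for t|x-a|<1, since R is not a real number when t|x-a|≥1; the claims about r hold for all t>0. *)

(* Defs.v *)
From mathcomp Require Export all_boot all_order all_algebra.
From mathcomp Require Export all_classical all_reals all_analysis.

Set Implicit Arguments.
Unset Strict Implicit.
Unset Printing Implicit Defensive.

Import Order.TTheory GRing.Theory Num.Theory.
Import numFieldNormedType.Exports.

Local Open Scope classical_set_scope.
Local Open Scope ring_scope.

(* The library norm `|v| on 'rV[R]_n is the sup norm, so the Euclidean norm
   is defined here. Both induce the same topology, hence [boundary] below,
   which uses the library topology of 'rV[R]_n, is the Euclidean boundary. *)
Definition enorm (R : realType) (n : nat) (v : 'rV[R]_n) : R :=
  Num.sqrt (\sum_(i < n) v ord0 i ^+ 2).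

Definition boundary (T : topologicalType) (A : set T) : set T :=
  closure A `\` interior A.

(* Only points of R^n occur in [boundary D]: the point at infinity never does.
   For x, y in an open D different from set0 and setT, the set below is
   nonempty and bounded, so the real-valued [sup] is the true supremum. *)
Definition cassinian (R : realType) (n : nat) (D : set 'rV[R]_n)
    (x y : 'rV[R]_n) : R :=
  sup [set enorm (x - y) / (enorm (x - p) * enorm (p - y)) | p in boundary D].

Definition bdist (R : realType) (n : nat) (D : set 'rV[R]_n)
    (z : 'rV[R]_n) : R :=
  inf [set enorm (z - p) | p in boundary D].

Definition distance_ratio (R : realType) (n : nat) (D : set 'rV[R]_n)
    (x y : 'rV[R]_n) : R :=
  ln (1 + enorm (x - y) / Num.min (bdist D x) (bdist D y)).

Definition cassinian_ball (R : realType) (n : nat) (D : set 'rV[R]_n)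
    (x : 'rV[R]_n) (t : R) : set 'rV[R]_n :=
  [set y | D y /\ cassinian D x y < t].

Definition distance_ratio_ball (R : realType) (n : nat) (D : set 'rV[R]_n)
    (x : 'rV[R]_n) (s : R) : set 'rV[R]_n :=
  [set y | D y /\ distance_ratio D x y < s].

(* Main.v *)
Require Import Defs.
From mathcomp Require Import ring lra.
Import Order.TTheory GRing.Theory Num.Theory.
Import numFieldNormedType.Exports.

(** In the punctured space the boundary is the single point a.  Write
    rho = |x - a|, s = |y - a| and d = |x - y|; then the two metrics are
    c = d / (rho * s) and j = ln (1 + d / min (rho, s)).

    The first inclusion is monotonicity: if d / min (rho, s) < t * rho, then
    d < t * rho * min (rho, s) <= (t * rho) * s.  For the second, d < t * rho * s
    together with s <= rho + d gives d * (1 - t * rho) < t * rho * rho, and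
    d * (1 - t * rho) <= d < t * rho * s holds as well, so that
    d / min (rho, s) < t * rho / (1 - t * rho) = 1 / (1 - t * rho) - 1.

    Both radii are attained or approached on the ray from a through x.  At
    y = a + l (x - a) one has c = |1 - l| / (l * rho) and
    j = ln (1 + |1 - l| / min (1, l)), that is j = |ln l|.
    For l = 1 / (1 + t * rho), between a and x, this gives c = t and j = r
    exactly, so no j-ball of radius larger than r fits in the c-ball
    ([distance_ratio_ball_radius_le]).  For 1 < l < 1 / (1 - t * rho), beyond x,
    it gives c < t and j = ln l, which comes as close to R as desired
    ([cassinian_ball_radius_ge]).

    Finally, with z = t * rho, the bound ln u <= u - 1 applied to 1 + z, 1 - z
    and the inverses of both gives 1 <= R / r <= (1 + z) / (1 - z), and the
    limit follows by squeezing ([ln_ratio_bounds]). *)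

Set Implicit Arguments.
Unset Strict Implicit.
Unset Printing Implicit Defensive.

Local Open Scope classical_set_scope.
Local Open Scope ring_scope.

(** * The boundary of a punctured normed space *)

(** The complement of {a} is open, so only the density of the complement at a
    is at stake.  A second point b provides it: a + e (b - a) tends to a as e
    tends to 0 while never being equal to a. *)
Lemma boundary_setC1 (K : realType) (V : normedModType K) (a b : V) :
  b != a -> boundary (~` [set a]) = [set a].
Proof.
move=> ba; rewrite /boundary closure_setC.
have op : open (~` [set a]).
  apply/closed_openC/accessible_closed_set1/hausdorff_accessible.
  exact: norm_hausdorff.
have -> : (~` [set a])° = ~` [set a] by apply/interior_id.
rewrite setDE setCK; apply/setIidPr => _ -> /= aint.
have cv : a + e *: (b - a) @[e --> (0:K)^'+] --> a.
  rewrite -[X in _ --> X]addr0 -(scale0r (b - a)).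
  apply: cvgD; first exact: cvg_cst.
  by apply: cvgZr_tmp; apply: cvg_at_right_filter; exact: cvg_id.
have /cv near_a := aint.
have /filter_ex[e []] : \forall e \near (0 : K)^'+,
    0 < e /\ a + e *: (b - a) = a.
  by apply: filterI; [exact: nbhs_right_gt | exact: near_a].
move=> e0 /eqP; rewrite -subr_eq0 addrC addKr scaler_eq0 gt_eqF//=.
by rewrite subr_eq0 (negbTE ba).
Qed.

(** * The Euclidean norm *)

Section EuclideanNorm.
Variables (K : realType) (n : nat).
Implicit Types u v x y z : 'rV[K]_n.

Lemma sqr_enorm u : enorm u ^+ 2 = \sum_(i < n) u ord0 i ^+ 2.
Proof. by rewrite sqr_sqrtr// sumr_ge0// => i _; rewrite sqr_ge0. Qed.

Lemma enorm_ge0 u : 0 <= enorm u.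
Proof. exact: sqrtr_ge0. Qed.

Lemma enormZ (k : K) u : enorm (k *: u) = `|k| * enorm u.
Proof.
rewrite /enorm -sqrtr_sqr -sqrtrM ?sqr_ge0// mulr_sumr; congr Num.sqrt.
by apply: eq_bigr => i _; rewrite mxE exprMn.
Qed.

Lemma enormN u : enorm (- u) = enorm u.
Proof. by rewrite -scaleN1r enormZ normrN1 mul1r. Qed.

Lemma enorm_distC u v : enorm (u - v) = enorm (v - u).
Proof. by rewrite -enormN opprB. Qed.

Lemma enorm_eq0 u : (enorm u == 0) = (u == 0).
Proof.
apply/idP/eqP => [/eqP eu|->]; last first.
  by rewrite -(scale0r 0) enormZ normr0 mul0r.
have /psumr_eq0P su : \sum_(i < n) u ord0 i ^+ 2 = 0.
  by rewrite -sqr_enorm eu expr0n.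
apply/rowP => i; rewrite mxE; apply/eqP; rewrite -sqrf_eq0.
by apply/eqP/su => // j _; rewrite sqr_ge0.
Qed.

Lemma enorm_gt0 u : (0 < enorm u) = (u != 0).
Proof. by rewrite lt_def enorm_ge0 andbT enorm_eq0. Qed.

(** The Cauchy-Schwarz inequality.  For nonzero vectors it is the expansion of
    0 <= | |v| u - |u| v |^2, whose right-hand side equals
    2 |u| |v| (|u| |v| - <u, v>). *)
Lemma dot_le_enormM u v :
  \sum_(i < n) u ord0 i * v ord0 i <= enorm u * enorm v.
Proof.
have [->|u0] := eqVneq u 0.
  rewrite big1 ?mulr_ge0 ?enorm_ge0// => i _.
  by rewrite mxE mul0r.
have [->|v0] := eqVneq v 0.
  rewrite big1 ?mulr_ge0 ?enorm_ge0// => i _.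
  by rewrite mxE mulr0.
have : 0 <= \sum_(i < n) (enorm v * u ord0 i - enorm u * v ord0 i) ^+ 2.
  by rewrite sumr_ge0// => i _; rewrite sqr_ge0.
have -> : \sum_(i < n) (enorm v * u ord0 i - enorm u * v ord0 i) ^+ 2 =
    2 * (enorm u * enorm v) *
      (enorm u * enorm v - \sum_(i < n) u ord0 i * v ord0 i).
  transitivity (enorm v ^+ 2 * (\sum_(i < n) u ord0 i ^+ 2)
    + enorm u ^+ 2 * (\sum_(i < n) v ord0 i ^+ 2)
    - 2 * (enorm u * enorm v) * \sum_(i < n) u ord0 i * v ord0 i).
    rewrite !mulr_sumr -big_split -sumrB /=.
    by apply: eq_bigr => i _; ring.
  by rewrite -!sqr_enorm; ring.
by rewrite pmulr_rge0 ?subr_ge0// !mulr_gt0 ?enorm_gt0.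
Qed.

Lemma ler_enormD u v : enorm (u + v) <= enorm u + enorm v.
Proof.
rewrite -ler_sqr ?nnegrE ?addr_ge0 ?enorm_ge0//.
rewrite sqr_enorm.
have -> : \sum_(i < n) (u + v) ord0 i ^+ 2 = enorm u ^+ 2 +
    2 * (\sum_(i < n) u ord0 i * v ord0 i) + enorm v ^+ 2.
  rewrite !sqr_enorm mulr_sumr -!big_split /=.
  by apply: eq_bigr => i _; rewrite mxE; ring.
by have := dot_le_enormM u v; lra.
Qed.

End EuclideanNorm.

(** * Balls in the punctured space *)

Section PuncturedSpace.
Variables (K : realType) (n : nat) (a x : 'rV[K]_n).
Hypothesis xa : x != a.
Let D : set 'rV[K]_n := ~` [set a].
Local Notation rho := (enorm (x - a)).

Lemma cassinian_punctured y :
  cassinian D x y = enorm (x - y) / (enorm (x - a) * enorm (y - a)).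
Proof.
by rewrite /cassinian (boundary_setC1 xa) image_set1 sup1 (enorm_distC a).
Qed.

Lemma distance_ratio_punctured y :
  distance_ratio D x y =
    ln (1 + enorm (x - y) / Num.min (enorm (x - a)) (enorm (y - a))).
Proof.
by rewrite /distance_ratio /bdist (boundary_setC1 xa) !image_set1 !inf1.
Qed.

Lemma punctured_distance_gt0 y : D y -> 0 < enorm (y - a).
Proof. by move=> /eqP ya; rewrite enorm_gt0 subr_eq0. Qed.

Lemma rho_gt0 : 0 < rho. Proof. by rewrite enorm_gt0 subr_eq0. Qed.

(** The extremal points for both inclusions lie on this ray: on it |x - a|,
    |y - a| and |x - y| are proportional, with factors depending on l only. *)
Definition ray_point (l : K) := a + l *: (x - a).

Lemma ray_point_punctured l : 0 < l -> D (ray_point l).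
Proof.
move=> l0; apply/eqP; rewrite /ray_point -subr_eq0 addrC addKr.
by rewrite scaler_eq0 gt_eqF//= subr_eq0.
Qed.

Lemma enorm_ray_point l : 0 < l -> enorm (ray_point l - a) = l * rho.
Proof. by move=> l0; rewrite /ray_point addrC addKr enormZ gtr0_norm. Qed.

Lemma enorm_subr_ray_point l : enorm (x - ray_point l) = `|1 - l| * rho.
Proof.
by rewrite -enormZ scalerBl scale1r /ray_point opprD addrA.
Qed.

Lemma cassinian_ray_point l : 0 < l ->
  cassinian D x (ray_point l) = `|1 - l| / (l * rho).
Proof.
move=> l0; rewrite cassinian_punctured enorm_ray_point// enorm_subr_ray_point.
by have r0 := rho_gt0; field; rewrite !gt_eqF.
Qed.

Lemma distance_ratio_ray_point l : 0 < l ->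
  distance_ratio D x (ray_point l) = ln (1 + `|1 - l| / Num.min 1 l).
Proof.
move=> l0; rewrite distance_ratio_punctured enorm_ray_point//.
rewrite enorm_subr_ray_point -{2}[rho]mul1r -minr_pMl ?ltW ?rho_gt0//.
have r0 := rho_gt0.
have m0 : 0 < Num.min 1 l by rewrite lt_min ltr01.
by congr (ln (1 + _)); field; rewrite !gt_eqF.
Qed.

Variable t : K.
Hypothesis t0 : 0 < t.

Lemma distance_ratio_ball_sub_cassinian_ball :
  distance_ratio_ball D x (ln (1 + t * rho)) `<=` cassinian_ball D x t.
Proof.
move=> y [Dy]; rewrite distance_ratio_punctured => jlt.
split=> //; rewrite cassinian_punctured.
have r0 := rho_gt0; have s0 := punctured_distance_gt0 Dy.
move: jlt; set m := Num.min _ _.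
have m0 : 0 < m by rewrite lt_min r0.
have d0 := enorm_ge0 (x - y).
rewrite ltr_ln ?posrE; last 2 first.
- by rewrite ltr_wpDr// divr_ge0// ltW.
- by rewrite addr_gt0// mulr_gt0.
rewrite ltrD2l ltr_pdivrMr// => dlt.
rewrite ltr_pdivrMr ?mulr_gt0// mulrA; apply: lt_le_trans dlt _.
by rewrite ler_pM2l ?mulr_gt0// ge_min lexx orbT.
Qed.

(** A larger j-ball would contain a point at which c is equal to t, and such a
    point is not in the c-ball. *)
Lemma distance_ratio_ball_radius_le r' :
  distance_ratio_ball D x r' `<=` cassinian_ball D x t ->
  r' <= ln (1 + t * rho).
Proof.
move=> sub; rewrite leNgt; apply/negP => rr'.
have r0 := rho_gt0; have z0 : 0 < t * rho by rewrite mulr_gt0.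
(* The solution in ]0, 1[ of (1 - l) / (l * rho) = t. *)
pose l := (1 + t * rho)^-1.
have l0 : 0 < l by rewrite invr_gt0 addr_gt0.
have l1 : l <= 1 by rewrite invf_le1 ?lerDl ?addr_gt0// ltW.
have nl : `|1 - l| = t * rho * l.
  rewrite ger0_norm ?subr_ge0// /l; field.
  by rewrite gt_eqF ?addr_gt0.
have [|_] := sub (ray_point l).
  split; first exact: ray_point_punctured.
  rewrite distance_ratio_ray_point// nl.
  by rewrite min_r// mulfK ?gt_eqF.
rewrite cassinian_ray_point// nl.
suff -> : t * rho * l / (l * rho) = t by rewrite ltxx.
by field; rewrite !gt_eqF.
Qed.

Hypothesis z1 : t * rho < 1.

(** The minimum of |x - a| and |y - a| splits the goal into two bounds on
    |x - y|.  The one against |x - a| is where the triangle inequality enters: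
    it turns the control by |y - a| into a control by |x - a|, at the cost of
    the factor 1 / (1 - t * rho). *)
Lemma cassinian_ball_sub_distance_ratio_ball :
  cassinian_ball D x t `<=` distance_ratio_ball D x (ln (1 / (1 - t * rho))).
Proof.
move=> y [Dy]; rewrite cassinian_punctured => clt.
split=> //; rewrite distance_ratio_punctured.
have r0 := rho_gt0; have s0 := punctured_distance_gt0 Dy.
have z0 : 0 < t * rho by rewrite mulr_gt0.
move: clt; rewrite ltr_pdivrMr ?mulr_gt0// mulrA => dlt.
have tri : enorm (y - a) <= rho + enorm (x - y).
  have -> : y - a = (x - a) - (x - y) by rewrite opprB [RHS]addrC addrA subrK.
  by rewrite -(enormN (x - y)) ler_enormD.
set m := Num.min _ _.
have m0 : 0 < m by rewrite lt_min r0.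
have d0 := enorm_ge0 (x - y).
have dm : enorm (x - y) * (1 - t * rho) < t * rho * m.
  rewrite /m; case: (leP rho) => _.
    have tri_z : t * rho * enorm (y - a) <= t * rho * (rho + enorm (x - y)).
      by rewrite ler_pM2l.
    lra.
  apply: le_lt_trans dlt; rewrite ler_piMr//; lra.
rewrite ltr_ln ?posrE; last 2 first.
- by rewrite ltr_wpDr// divr_ge0// ltW.
- by rewrite divr_gt0// subr_gt0.
have -> : 1 / (1 - t * rho) = 1 + t * rho / (1 - t * rho).
  by field; rewrite gt_eqF// subr_gt0.
rewrite ltrD2l ltr_pdivrMr// mulrAC ltr_pdivlMr ?subr_gt0//.
Qed.

(** The ray points with 1 < l < 1 / (1 - t * rho) all lie in the c-ball and are
    at j-distance ln l from x, so R' has to dominate every such ln l. *)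
Lemma cassinian_ball_radius_ge R' :
  cassinian_ball D x t `<=` distance_ratio_ball D x R' ->
  ln (1 / (1 - t * rho)) <= R'.
Proof.
move=> sub; rewrite leNgt; apply/negP => RR'.
have r0 := rho_gt0; have z0 : 0 < t * rho by rewrite mulr_gt0.
set L := 1 / _ in RR'.
have L0 : 0 < L by rewrite divr_gt0// subr_gt0.
have L1 : 1 < L by rewrite /L div1r invf_gt1 ?subr_gt0//; lra.
have [l /andP[l1 Rl] lL] : exists2 l, (1 < l) && (expR R' < l) & l < L.
  have maxL : Num.max 1 (expR R') < L.
    by rewrite gt_max L1 -[ltRHS]lnK ?posrE// ltr_expR.
  exists ((Num.max 1 (expR R') + L) / 2).
    by rewrite -gt_max; case: (midf_lt maxL).
  by case: (midf_lt maxL).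
have l0 : 0 < l by apply: lt_trans l1.
have nl : `|1 - l| = l - 1 by rewrite ltr0_norm ?opprB// subr_lt0.
have [|_] := sub (ray_point l).
  split; first exact: ray_point_punctured.
  rewrite cassinian_ray_point// nl ltr_pdivrMr ?mulr_gt0//.
  move: lL; rewrite /L ltr_pdivlMr ?subr_gt0//; lra.
rewrite distance_ratio_ray_point// nl min_l ?ltW// divr1 addrCA subrr addr0.
by rewrite -ltr_expR lnK ?posrE// ltNge ltW.
Qed.

End PuncturedSpace.

(** * The ratio of the radii *)

Lemma ln_ratio_bounds (K : realType) (z : K) : 0 < z -> z < 1 ->
  1 <= ln (1 / (1 - z)) / ln (1 + z) <= (1 + z) / (1 - z).
Proof.
move=> z0 z1.
have ln_le (u : K) : 0 < u -> ln u <= u - 1.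
  move=> u0; have := @le_ln1Dx _ (u - 1); rewrite addrCA subrr addr0.
  by apply; lra.
have p0 : 0 < 1 + z by lra.
have q0 : 0 < 1 - z by lra.
have lp : 0 < ln (1 + z) by rewrite ln_gt0// ltrDl.
have lle : ln (1 + z) <= z by have := ln_le _ p0; lra.
have lge : z / (1 + z) <= ln (1 + z).
  have := ln_le (1 + z)^-1; rewrite invr_gt0 lnV// => /(_ p0).
  have -> : z / (1 + z) = 1 - (1 + z)^-1 by field; rewrite gt_eqF.
  by lra.
have Rge : z <= ln (1 / (1 - z)).
  by rewrite div1r lnV//; have := ln_le _ q0; lra.
have Rle : ln (1 / (1 - z)) <= z / (1 - z).
  have -> : z / (1 - z) = 1 / (1 - z) - 1 by field; rewrite gt_eqF.
  by apply: ln_le; rewrite divr_gt0.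
apply/andP; split.
  by rewrite ler_pdivlMr// [leLHS]mul1r; apply: le_trans lle Rge.
rewrite ler_pdivrMr//; apply: (le_trans Rle).
have -> : z / (1 - z) = (1 + z) / (1 - z) * (z / (1 + z)).
  by field; rewrite !gt_eqF.
by rewrite ler_pM2l// divr_gt0.
Qed.

Lemma ln_ratio_cvg1 (K : realType) (c : K) : 0 < c ->
  ln (1 / (1 - t * c)) / ln (1 + t * c) @[t --> 0^'+] --> (1 : K).
Proof.
move=> c0.
apply: (@squeeze_cvgr _ _ _ _ (fun=> 1) (fun t => (1 + t * c) / (1 - t * c))).
- near=> t; apply: ln_ratio_bounds.
    by rewrite mulr_gt0//; near: t; exact: nbhs_right_gt.
  rewrite -ltr_pdivlMr//; near: t; apply: nbhs_right_lt.
  by rewrite divr_gt0.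
- exact: cvg_cst.
- have tc : t * c @[t --> (0 : K)^'+] --> 0.
    rewrite -[X in _ --> X](mul0r c); apply: cvgM; last exact: cvg_cst.
    by apply: cvg_at_right_filter; exact: cvg_id.
  have lim1 : (1 + 0) / (1 - 0) = 1 :> K by rewrite addr0 subr0 divr1.
  rewrite -[X in _ --> X]lim1.
  apply: cvgM; first by apply: cvgD => //; exact: cvg_cst.
  apply: cvgV; first by rewrite subr0 oner_eq0.
  by apply: cvgB => //; exact: cvg_cst.
Unshelve. all: by end_near. Qed.

(** * Comparison of the balls *)

Theorem theorem5p4 (K : realType) (n : nat) (n_ge2 : (2 <= n)%N)
    (a x : 'rV[K]_n) :
  let D : set 'rV[K]_n := ~` [set a] in
  let r : K -> K := fun t => ln (1 + t * enorm (x - a)) in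
  let R : K -> K := fun t => ln (1 / (1 - t * enorm (x - a))) in
  D x ->
  (forall t : K, 0 < t ->
     [/\ distance_ratio_ball D x (r t) `<=` cassinian_ball D x t,
         (forall r' : K,
            distance_ratio_ball D x r' `<=` cassinian_ball D x t -> r' <= r t)
       & t * enorm (x - a) < 1 ->
         cassinian_ball D x t `<=` distance_ratio_ball D x (R t) /\
         (forall R' : K,
            cassinian_ball D x t `<=` distance_ratio_ball D x R' -> R t <= R')])
  /\ R t / r t @[t --> 0^'+] --> (1 : K).
Proof.
move=> D r R /eqP xa; split; last by apply: ln_ratio_cvg1; exact: rho_gt0.
move=> t t0; split.
- exact: distance_ratio_ball_sub_cassinian_ball.
- exact: distance_ratio_ball_radius_le.
- move=> z1; split; first exact: cassinian_ball_sub_distance_ratio_ball.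
  exact: cassinian_ball_radius_ge.
Qed.
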